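(* Let $G$ be a chordal graph with the base tree $T$ and overspan graphs defined in the context. Let $e$ be an edge of $T$, let $A_e$ be the overspan graph assigned to $e$, and let $C$ be a vertex cover of $A_e$. Define $S\subseteq V(G)$ by $S=C$ if $e$ is black, and $S=C\cup\{x\}$ if $e$ is red, where $x\in I$ is the vertex whose $I$-path $F_x$ corresponds to $e$. If vertices $u,v$ of $G-S$ form an $e$-enclosing pair, then $u$ and $v$ lie in different components of $G-S$.
   Context: A tree representation of a graph $G$ is a tree $T_0$ with a family $\mathcal F=\{F_v: v\in V(G)\}$ of subtrees of $T_0$ such that for distinct $u,v$, $uv\in E(G)$ iff $F_u$ and $F_v$ share a vertex. Fix one with $|V(T_0)|$ minimum. Choose an independent set $I$ of $G$ maximal with the property that for each $v\in I$, $F_v$ is a path all of whose vertices have degree at most $2$ in $T_0$; moreover $I$ is chosen so that for every $v\in I$, $F_v$ contains no member of $\mathcal F$ as a proper subgraph. For $v\in I$, $F_v$ is an $I$-path (trivial if it is a single vertex, which is then its endvertex). Colour each edge of $T_0$ red if it lies in some $I$-path and black otherwise. The base tree $T$ is obtained from $T_0$ by suppressing, one by one, every degree-$2$ vertex that is not an endvertex of any $I$-path; edges of $T$ inherit the colours, and each red edge of $T$ corresponds to a unique non-trivial $I$-path (the one it replaces). The vertices of $T_0$ that remain in $T$ are called substantial. For an edge $e=rs$ of $T$, the overspan graph $A_e$ has vertex set $V(G)\setminus I$; it has a loop at $v$ if $F_v$ contains both $r$ and $s$, and an edge between distinct $u,v$ if $uv\in E(G)$ and ($r\in V(F_u)$,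 $s\in V(F_v)$ or vice versa). A vertex cover of $A_e$ is a set of vertices meeting every edge, including loops (so looped vertices belong to it). Two vertices $u,v$ of $G$ form an $e$-enclosing pair if there are substantial vertices $s\in V(F_u)$ and $t\in V(F_v)$ lying in different components of $T-e$. *)

(* Defs.v *)
From mathcomp Require Import all_boot.

Set Implicit Arguments.
Unset Strict Implicit.
Unset Printing Implicit Defensive.

Section Graphs.
Variables (T : finType) (E : rel T).
Implicit Types (A : {set T}) (c : seq T).

Definition simple_graph := symmetric E /\ irreflexive E.

Definition induced A : rel T := [rel x y | [&& x \in A, y \in A & E x y]].

Definition connected_in A := {in A &, forall x y, connect (induced A) x y}.

Definition independent A := {in A &, forall x y, ~~ E x y}.

(* With E symmetric and irreflexive, the E-cycles without repeated vertices of
   size at least 3 are exactly the cycles of the graph; [::] and [:: x; y] are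
   degenerate ones. *)
Definition acyclic := forall c, ucycle E c -> size c <= 2.

Definition chordal := forall c, ucycle E c -> 4 <= size c ->
  exists x y, [/\ x \in c, y \in c, E x y, y != next c x & x != next c y].

Definition tree :=
  [/\ simple_graph, 0 < #|T|, connected_in setT & acyclic].

(* Subtrees of a tree are represented by their vertex sets: a subtree of a tree
   is the subgraph induced by its vertices. *)
Definition subtree A := A != set0 /\ connected_in A.

Definition degree_in A x := #|[set y in A | E x y]|.

Definition is_path A :=
  exists x p, [/\ path E x p, uniq (x :: p) & A = [set z in x :: p]].

(* The single vertex of a trivial path is an endvertex. *)
Definition path_endvertex A x := (x \in A) && (degree_in A x <= 1).

End Graphs.

Definition tree_rep (V T0 : finType) (G : rel V) (E0 : rel T0)
    (F : V -> {set T0}) :=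
  [/\ tree E0, forall v, subtree E0 (F v) &
      forall u v, u != v -> G u v = ~~ [disjoint F u & F v]].

Definition minimum_tree_rep (V T0 : finType) (G : rel V) (E0 : rel T0)
    (F : V -> {set T0}) :=
  tree_rep G E0 F /\
  forall (T1 : finType) (E1 : rel T1) (F1 : V -> {set T1}),
    tree_rep G E1 F1 -> #|T0| <= #|T1|.

(* A tree obtained from a tree on T0 by suppressing vertices. For an edge xy,
   [replaced x y] is the vertex set of the path of the original tree that the
   edge stands for. *)
Record ctree (T0 : finType) := CTree {
  verts : {set T0};
  adj : rel T0;
  red : rel T0;
  replaced : T0 -> T0 -> {set T0}
}.

Section BaseTree.
Variables (V T0 : finType) (G : rel V) (E0 : rel T0) (F : V -> {set T0}).
Implicit Types (I J C : {set V}) (K : ctree T0) (r s w a b : T0) (u v : V).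

Definition ipath_property I :=
  independent G I /\
  forall v, v \in I ->
    is_path E0 (F v) /\ {in F v, forall t, degree_in E0 setT t <= 2}.

Definition admissible_choice I :=
  [/\ ipath_property I,
      forall J, ipath_property J -> I \subset J -> J = I &
      forall v, v \in I -> forall u, ~~ (F u \proper F v)].

Definition ipath_endvertex I w := [exists v in I, path_endvertex E0 (F v) w].

Definition ipath_edge I : rel T0 :=
  [rel x y | E0 x y && [exists v in I, (x \in F v) && (y \in F v)]].

Definition initial_ctree I : ctree T0 :=
  CTree setT E0 (ipath_edge I) (fun x y => [set x; y]).

Definition suppressible I K w a b :=
  [/\ w \in verts K, a != b, [set y | adj K w y] = [set a; b] &
      ~~ ipath_endvertex I w].

(* The edges wa and wb have the same colour, since w is not an endvertex of an
   I-path; the new edge ab inherits it. *)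
Definition suppress K w a b : ctree T0 :=
  let new x y := [set x; y] == [set a; b] in
  CTree (verts K :\ w)
    [rel x y | new x y || [&& x != w, y != w & adj K x y]]
    [rel x y | if new x y then red K w a else red K x y]
    (fun x y => if new x y then replaced K w a :|: replaced K w b
                else replaced K x y).

Inductive suppresses_to I : ctree T0 -> ctree T0 -> Prop :=
| suppresses_refl K : suppresses_to I K K
| suppresses_step K w a b K' : suppressible I K w a b ->
    suppresses_to I (suppress K w a b) K' -> suppresses_to I K K'.

Definition base_tree I K :=
  suppresses_to I (initial_ctree I) K /\
  forall w a b, ~ suppressible I K w a b.

Definition substantial K : {set T0} := verts K.

Definition corresponding_ipath I K r s (x : V) :=
  [/\ x \in I, 1 < #|F x| & F x = replaced K r s].

(* The overspan graph of the edge rs, with vertex set ~: I; its loops are the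
   diagonal pairs. *)
Definition overspan I r s : rel V :=
  [rel u v | [&& u \notin I, v \notin I &
    if u == v then (r \in F u) && (s \in F u)
    else G u v && ((r \in F u) && (s \in F v) || (s \in F u) && (r \in F v))]].

Definition overspan_cover I r s C :=
  C \subset ~: I /\ forall u v, overspan I r s u v -> (u \in C) || (v \in C).

Definition del_edge K r s : rel T0 :=
  [rel x y | adj K x y && ([set x; y] != [set r; s])].

Definition enclosing_pair K r s u v :=
  exists p q, [/\ p \in substantial K :&: F u, q \in substantial K :&: F v &
                  ~~ connect (del_edge K r s) p q].

End BaseTree.

(* Main.v *)
(** Let [P] be the path of [T0] replaced by the edge [rs]. Its inner vertices have
degree 2 and are not endvertices of [I]-paths, so an [I]-path meeting the interior
of [P] contains all of [P]. Hence no [F z] lies inside the interior of [P]: by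
maximality of [I] it would meet such an [I]-path and be properly contained in it.
Let [A] and [B] be the parts of [T0] beyond [r] and [s]. Along a walk in [G - S]
from [u] to [v], consider a step from some [z] with [F z] meeting [A] to
some [z'] with [F z'] missing [A]. Since no vertex outside [S] has a subtree
containing both [r] and [s], this forces [r \in F z] and [s \in F z'], and neither
[z] nor [z'] lies in [I]; so [zz'] is an edge of the overspan graph that [C] does
not cover. *)

Require Import Defs.
From mathcomp Require Import all_boot.

Set Implicit Arguments.
Unset Strict Implicit.
Unset Printing Implicit Defensive.

Section Graphs.
Variables (T : finType) (E : rel T).
Implicit Types (A X : {set T}).

Lemma set2_eqP (x y a b : T) :
  [set x; y] = [set a; b] -> x = a /\ y = b \/ x = b /\ y = a.
Proof.
move=> eqS.
have /set2P xP : x \in [set a; b] by rewrite -eqS set21.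
have /set2P yP : y \in [set a; b] by rewrite -eqS set22.
have /set2P aP : a \in [set x; y] by rewrite eqS set21.
have /set2P bP : b \in [set x; y] by rewrite eqS set22.
case: xP yP aP bP => -> [->|->] aP bP; try by [left | right].
  by case: bP => ->; left.
by case: aP => ->; left.
Qed.

Lemma set2_neqr (x y a w : T) : x != w -> y != w -> [set x; y] != [set a; w].
Proof.
move=> xw yw; apply/eqP => eqS.
have : w \in [set x; y] by rewrite eqS set22.
by rewrite !inE ![w == _]eq_sym (negPf xw) (negPf yw).
Qed.

Lemma connect_crossing (e : rel T) A x y :
  connect e x y -> x \in A -> y \notin A ->
  exists t t', [/\ e t t', t \in A & t' \notin A].
Proof.
case/connectP=> p; elim: p x => [|z p IHp] x /=.
  by move=> _ -> ->.
case/andP=> exz pth yE xA yA.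
case: (boolP (z \in A)) => [zA|zA]; first exact: (IHp z).
by exists x, z.
Qed.

Lemma connected_crossing X A x y :
  connected_in E X -> x \in X -> y \in X -> x \in A -> y \notin A ->
  exists t t', [/\ t \in X, t' \in X, E t t', t \in A & t' \notin A].
Proof.
move=> connX xX yX xA yA.
have [t [t' [/and3P[tX t'X Ett'] tA t'A]]] :=
  connect_crossing (connX x y xX yX) xA yA.
by exists t, t'.
Qed.

Lemma acyclic_bridge x y :
  simple_graph E -> acyclic E -> E x y ->
  ~~ connect [rel a b | E a b && ([set a; b] != [set x; y])] x y.
Proof.
case=> symE irrE acycE Exy; apply/negP => /connectP[p pth yE].
have {p pth yE}[p [pth up yE]] : exists p,
    [/\ path [rel a b | E a b && ([set a; b] != [set x; y])] x p,
        uniq (x :: p) & y = last x p].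
  by case/shortenP: pth yE => p' pth' up' _ yE; exists p'.
have pthE : path E x p by apply: sub_path pth => a b /andP[].
have cyc : ucycle E (x :: p).
  by rewrite /ucycle up /= rcons_path pthE -yE symE Exy.
have := acycE _ cyc.
case: p pth yE {up pthE cyc} => [|z [|//]] /=.
  by move=> _ yx; rewrite yx irrE in Exy.
by move=> /andP[/andP[_ neq] _] yz; rewrite yz eqxx in neq.
Qed.

(* A longest path inside [A] covers [A]: an outside neighbour of an end would
   extend it, and one of an inner vertex would give that vertex degree 3. *)
Lemma connected_degree2_is_path A :
  symmetric E -> subtree E A -> {in A, forall t, degree_in E setT t <= 2} ->
  is_path E A.
Proof.
move=> symE [/set0Pn[x0 x0A] connA] deg2.
pose P n := [exists p : n.-tuple T,
  [&& sorted E p, uniq p & all (mem A) p]].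
have P1 : P 1 by apply/existsP; exists [tuple x0]; rewrite /= x0A.
have Pb n : P n -> n <= #|T|.
  case/existsP=> p /and3P[_ /card_uniqP up _].
  by rewrite -(size_tuple p) -up max_card.
case: (ex_maxnP (ex_intro _ 1 P1) Pb) => n /existsP[p].
case/and3P; case: {p}(tval p) (size_tuple p) => [|x p] sz_p pth up /allP pA maxn.
  by have := maxn 1 P1; rewrite -sz_p.
exists x, p; split=> //; apply/eqP; rewrite eq_sym eqEsubset.
apply/andP; split; first by apply/subsetP => z; rewrite inE => /pA.
apply/subsetP => z zA; apply/negPn/negP => zp.
have xA : x \in A by apply: pA; rewrite inE eqxx.
have [|t [t' [tA t'A Ett']]] := connected_crossing connA xA zA _ zp.
  by rewrite !inE eqxx.
rewrite !in_set => tp t'p.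
have longer q : sorted E q -> uniq q -> all (mem A) q -> size q = n.+1 -> False.
  move=> qE uq qA sz_q; have : P n.+1; last by move/maxn; rewrite ltnn.
  apply/existsP; exists (tcast sz_q (in_tuple q)).
  by rewrite val_tcast /= qE uq qA.
have pA' : all (mem A) (x :: p) by apply/allP => y /pA.
have {}pth : sorted E (x :: p) by [].
move: (x :: p) sz_p pth up pA' tp t'p longer => {maxn zp pA xA}{}p.
move=> sz_p pth up pA tp; case/splitPr: tp sz_p pth up pA => s1 s2.
rewrite sorted_cat_cons all_cat cat_uniq size_cat mem_cat negb_or /= !inE negb_or.
move=> sz_p /andP[pth1 pth2] /and4P[us1]; rewrite negb_or.
move=> /andP[ts1 s12] ts2 us2 /and3P[s1A _ s2A] /and3P[t's1 t't t's2] longer.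
case/lastP: s1 => [|s1 a] in sz_p pth1 us1 ts1 s12 s1A t's1.
  apply: (longer [:: t', t & s2]); rewrite /= ?inE ?negb_or ?t't ?t's2 ?ts2 //.
  - by rewrite symE Ett'.
  - by rewrite t'A tA.
  - by rewrite -sz_p.
case: s2 => [|b s2] in sz_p pth2 ts2 us2 s12 s2A t's2.
  apply: (longer (rcons (rcons (rcons s1 a) t) t')).
  - by case: (s1) pth1 => [|c s] /=; rewrite ?rcons_path ?last_rcons Ett' !andbT.
  - by rewrite rcons_uniq mem_rcons inE negb_or t't t's1 rcons_uniq ts1.
  - by move: s1A; rewrite !all_rcons /= t'A tA.
  - by rewrite !size_rcons -sz_p size_rcons addn1.
have : #|[set a; b; t']| <= #|[set y in setT | E t y]|.
  apply: subset_leq_card; apply/subsetP => y; rewrite !inE => /orP[/orP[]|] /eqP-> //.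
    move: pth1; case: (s1) => [|c s] /=; first by rewrite andbT symE.
    by rewrite !rcons_path last_rcons [E t a]symE => /andP[_ ->].
  by case/andP: pth2.
have -> : #|[set a; b; t']| = 3.
  have ab : a != b.
    apply: contraNneq s12 => <-; apply/orP; left.
    by rewrite mem_rcons inE eqxx.
  move: t's1 t's2; rewrite mem_rcons !inE !negb_or => /andP[t'a _] /andP[t'b _].
  by rewrite setUC cardsU1 cards2 !inE negb_or t'a t'b ab.
by move/leq_trans/(_ (deg2 _ tA)).
Qed.




End Graphs.

Section Reduction.
Variables (V T0 : finType) (E0 : rel T0) (F : V -> {set T0}) (I : {set V}).
Hypothesis treeE0 : tree E0.
Hypothesis subtreeF : forall v, subtree E0 (F v).
Implicit Types (K : ctree T0) (D : {set T0}) (x y t : T0).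

(* The edges of [K] stand for paths of [E0] that cover [E0] and whose interiors
   are pairwise disjoint and avoid [verts K]. *)
Record reduction K : Prop := Reduction {
  adj_sym : symmetric (adj K);
  adj_verts : forall x y, adj K x y -> [/\ x \in verts K, y \in verts K & x != y];
  adj_bridge : forall x y, adj K x y -> ~~ connect (del_edge K x y) x y;
  replaced_sym : forall x y, replaced K x y = replaced K y x;
  replaced_end : forall x y, adj K x y -> x \in replaced K x y;
  replaced_verts : forall x y t, adj K x y -> t \in verts K ->
    t \in replaced K x y -> t = x \/ t = y;
  replaced_cover : forall t t', E0 t t' ->
    exists x y, [/\ adj K x y, t \in replaced K x y & t' \in replaced K x y];
  replaced_interior : forall x y x' y' t, t \notin verts K ->
    adj K x y -> adj K x' y' -> t \in replaced K x y -> t \in replaced K x' y' ->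
    [set x; y] = [set x'; y'];
  replaced_start : forall x y, adj K x y ->
    exists z, [/\ E0 x z, z \in replaced K x y & z != x];
  replaced_start_uniq : forall x y t t', adj K x y -> E0 x t -> E0 x t' ->
    t \in replaced K x y -> t' \in replaced K x y -> t = t';
  replaced_walk : forall x y t, adj K x y -> t \in replaced K x y -> t != x ->
    connect [rel a b | (a \notin verts K) && E0 a b] t y;
  suppressed_degree : forall t, t \notin verts K -> degree_in E0 setT t <= 2;
  suppressed_endvertex : forall t, t \notin verts K ->
    ~~ ipath_endvertex E0 F I t;
  red_ipath : forall x y v, adj K x y -> v \in I -> x \in F v -> y \in F v ->
    red K x y
}.

Definition side K D : {set T0} :=
  [set t | if t \in verts K then t \in D
           else [exists x in D, exists y in D,
                   adj K x y && (t \in replaced K x y)]].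

Section OneTree.
Variable K : ctree T0.
Hypothesis redK : reduction K.

Lemma side_verts D t : t \in verts K -> (t \in side K D) = (t \in D).
Proof. by rewrite inE => ->. Qed.

Lemma sideP D t : t \notin verts K ->
  reflect (exists x y, [/\ x \in D, y \in D, adj K x y & t \in replaced K x y])
          (t \in side K D).
Proof.
move=> tW; rewrite inE (negPf tW); apply: (iffP exists_inP).
  by case=> x xD /exists_inP[y yD /andP[? ?]]; exists x, y.
by case=> x [y [xD yD ? ?]]; exists x => //; apply/exists_inP; exists y => //; apply/andP.
Qed.

Lemma side_exit D t t' : E0 t t' -> t \in side K D -> t' \notin side K D ->
  exists2 y, adj K t y & t \in D /\ y \notin D.
Proof.
move=> Ett' tD t'D.
have [x [y [Kxy tR t'R]]] := replaced_cover redK Ett'.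
have [xW yW _] := adj_verts redK Kxy.
wlog xD : x y Kxy tR t'R xW yW / x \in D => [wl|].
  case: (boolP (x \in D)) => xD; first exact: (wl x y).
  case: (boolP (y \in D)) => yD.
    by apply: (wl y x) => //; rewrite 1?(adj_sym redK) // (replaced_sym redK).
  case: (boolP (t \in verts K)) => tW.
    move: tD; rewrite side_verts //.
    by case: (replaced_verts redK Kxy tW tR) => ->; rewrite ?(negPf xD) ?(negPf yD).
  case/sideP: tD => // x' [y' [x'D y'D Kxy' tR']].
  have := replaced_interior redK tW Kxy Kxy' tR tR'.
  by case/set2_eqP=> -[eqx _]; rewrite eqx ?x'D ?y'D in xD.
case: (boolP (y \in D)) => yD.
  case/negP: t'D; case: (boolP (t' \in verts K)) => t'W.
    by rewrite side_verts //; case: (replaced_verts redK Kxy t'W t'R) => ->.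
  by apply/sideP => //; exists x, y.
case: (boolP (t \in verts K)) => tW.
  move: tD; rewrite side_verts // => tD.
  case: (replaced_verts redK Kxy tW tR) => tE; last by rewrite tE (negPf yD) in tD.
  by exists y; rewrite tE.
case/sideP: tD => // x' [y' [x'D y'D Kxy' tR']].
have := replaced_interior redK tW Kxy Kxy' tR tR'.
by case/set2_eqP=> -[_ eqy]; rewrite eqy ?x'D ?y'D in yD.
Qed.

Lemma connected_side_exit (X D : {set T0}) t t' :
  connected_in E0 X -> t \in X -> t' \in X -> t \in side K D -> t' \notin side K D ->
  exists x y, [/\ x \in X, adj K x y, x \in D & y \notin D].
Proof.
move=> cX tX t'X tD t'D.
have [z [z' [zX _ Ezz' zD z'D]]] := connected_crossing cX tX t'X tD t'D.
by have [y Kzy [? ?]] := side_exit Ezz' zD z'D; exists z, y.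
Qed.

Lemma del_edge_sym r s : symmetric (del_edge K r s).
Proof. by move=> x y; rewrite /del_edge /= (adj_sym redK) [[set x; y]]setUC. Qed.

Definition branch r s p : {set T0} := [set t | connect (del_edge K r s) p t].

Lemma branch_exit r s p x y :
  adj K x y -> (x \in branch r s p) != (y \in branch r s p) ->
  [set x; y] = [set r; s].
Proof.
move=> Kxy; rewrite !inE => neq; apply/eqP; apply: contraNT neq => neq.
have Dxy : del_edge K r s x y by rewrite /del_edge /= Kxy.
by rewrite (same_connect1r (sym_connect_sym (del_edge_sym r s)) Dxy) eqxx.
Qed.

(* The path of [E0] in [F v] from [b] to [a] leaves the far side of the bridge
   [aw], which it can do only at [w]. *)
Lemma between_neighbours w a b v : adj K a w -> adj K w b -> a != b ->
  a \in F v -> b \in F v -> w \in F v.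
Proof.
move=> Kaw Kwb ab aF bF.
have [aW wW aw] := adj_verts redK Kaw; have [_ bW wb] := adj_verts redK Kwb.
have bD : b \notin branch a w a.
  rewrite inE; apply: contraNN (adj_bridge redK Kaw) => /connect_trans; apply.
  apply: connect1; rewrite /del_edge /= (adj_sym redK) Kwb [[set a; w]]setUC.
  by apply: set2_neqr; rewrite eq_sym.
have [|||x [y [xF Kxy xD yD]]] :=
  @connected_side_exit (F v) (~: branch a w a) b a _ bF aF.
- by case: (subtreeF v).
- by rewrite side_verts // inE.
- by rewrite side_verts // !inE negbK connect0.
rewrite !in_setC negbK in xD yD.
have := branch_exit (r := a) (s := w) (p := a) Kxy; rewrite (negPf xD) yD.
case/(_ isT)/set2_eqP => -[xE _]; last by rewrite -xE.
by rewrite xE inE connect0 in xD.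
Qed.

End OneTree.

Lemma reduction_initial : reduction (initial_ctree E0 F I).
Proof.
have [[symE irrE] _ _ acycE] := treeE0.
split=> //=.
- move=> x y Exy; rewrite !inE; split=> //.
  by apply: contraTneq Exy => ->; rewrite irrE.
- by move=> x y Exy; apply: acyclic_bridge.
- by move=> x y; rewrite setUC.
- by move=> x y _; rewrite set21.
- by move=> x y t _ _ /set2P.
- by move=> t t' Ett'; exists t, t'; rewrite set21 set22.
- by move=> x y x' y' t; rewrite inE.
- move=> x y Exy; exists y; rewrite set22; split=> //.
  by apply: contraTneq Exy => ->; rewrite irrE.
- move=> x y t t' _ Et Et' /set2P[] tE /set2P[] t'E; rewrite ?tE ?t'E //.
    by rewrite tE irrE in Et.
  by rewrite t'E irrE in Et'.
- by move=> x y t _ /set2P[] -> //; rewrite eqxx.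
- by move=> t; rewrite inE.
- by move=> t; rewrite inE.
- move=> x y v Exy vI xF yF; rewrite /ipath_edge /= Exy.
  by apply/existsP; exists v; rewrite vI xF yF.
Qed.

Lemma reduction_suppress K w a b :
  reduction K -> suppressible E0 F I K w a b -> reduction (suppress K w a b).
Proof.
move=> redK [wW ab nbrs wend]; set K' := suppress K w a b.
have [[symE irrE] _ _ _] := treeE0.
have Kw y : adj K w y = (y == a) || (y == b).
  by rewrite -(in_set2 y a b) -nbrs inE.
have Kwa : adj K w a by rewrite Kw eqxx.
have Kwb : adj K w b by rewrite Kw eqxx orbT.
have Kcw c : adj K w c -> adj K c w by rewrite (adj_sym redK).
have cW c : adj K w c -> c \in verts K by case/(adj_verts redK).
have cw c : adj K w c -> c != w by case/(adj_verts redK); rewrite eq_sym.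
have notri c d : adj K w c -> adj K w d -> c != d -> ~~ adj K c d.
  move=> Kwc Kwd cd; apply: contraNN (adj_bridge redK (Kcw c Kwc)) => Kcd.
  apply: (@connect_trans _ _ d); apply: connect1; rewrite /del_edge /= ?Kcd ?Kcw //=.
    by apply: set2_neqr; exact: cw.
  by rewrite [[set c; w]]setUC; apply: set2_neqr; rewrite eq_sym // cw.
have adjP x y : adj K' x y ->
    [\/ x = a /\ y = b, x = b /\ y = a |
        [/\ ([set x; y] == [set a; b]) = false, x != w, y != w & adj K x y]].
  rewrite /K' /=; case: eqP => [/set2_eqP[]|] /=; first by constructor 1.
    by constructor 2.
  by move=> _ /and3P[]; constructor 3.
have Rnew x y : [set x; y] = [set a; b] ->
    replaced K' x y = replaced K w a :|: replaced K w b.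
  by rewrite /K' /= => ->; rewrite eqxx.
have Rab := Rnew a b erefl; have Rba := Rnew b a (setUC _ _).
have Rold x y : ([set x; y] == [set a; b]) = false ->
    replaced K' x y = replaced K x y.
  by rewrite /K' /= => ->.
have Kab : adj K' a b by rewrite /K' /= eqxx.
have W'P t : (t \notin verts K') = (t == w) || (t \notin verts K).
  by rewrite /K' /= !inE negb_and negbK.
have start c : adj K w c -> exists z, [/\ E0 c z, z \in replaced K w c & z != c].
  by move=> /Kcw /(replaced_start redK); rewrite (replaced_sym redK).
have start_side c d t : adj K w c -> adj K w d -> c != d -> E0 c t ->
    t \in replaced K w d -> t \in replaced K w c.
  move=> Kwc Kwd cd Ect tR; have [x [y [Kxy cR tR']]] := replaced_cover redK Ect.
  have cxy : c \in [set x; y].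
    by apply/set2P; apply: replaced_verts redK _ _ _ Kxy (cW c Kwc) cR.
  case: (boolP (t \in verts K)) => tW.
    have [->|td] := replaced_verts redK Kwd tW tR; first exact: replaced_end.
    have dxy : d \in [set x; y].
      by rewrite -td; apply/set2P; apply: replaced_verts redK _ _ _ Kxy tW tR'.
    case/negP: (notri _ _ Kwc Kwd cd); move: cxy dxy cd.
    case/set2P=> -> /set2P[] ->; rewrite ?eqxx // => _.
    by rewrite (adj_sym redK).
  rewrite (replaced_interior redK tW Kxy Kwd tR' tR) !inE in cxy.
  by rewrite (negPf cd) (negPf (cw c Kwc)) in cxy.
have start_uniq c d t t' : adj K w c -> adj K w d -> c != d ->
    E0 c t -> E0 c t' -> t \in replaced K w c :|: replaced K w d ->
    t' \in replaced K w c :|: replaced K w d -> t = t'.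
  move=> Kwc Kwd cd Et Et' tR t'R.
  apply: (replaced_start_uniq redK (Kcw c Kwc)) => //; rewrite (replaced_sym redK).
    by case/setUP: tR => // tR; apply: start_side Et tR.
  by case/setUP: t'R => // t'R; apply: start_side Et' t'R.
have walk_sub x y : connect [rel a b | (a \notin verts K) && E0 a b] x y ->
    connect [rel a b | (a \notin verts K') && E0 a b] x y.
  apply: connect_sub => {x y} x y /andP[xW Exy].
  by apply: connect1; rewrite /= -/(verts K') W'P xW orbT Exy.
have walk c d t : adj K w c -> adj K w d -> c != d ->
    t \in replaced K w c :|: replaced K w d -> t != c ->
    connect [rel a b | (a \notin verts K') && E0 a b] t d.
  move=> Kwc Kwd cd tR tc.
  have wd : connect [rel a b | (a \notin verts K') && E0 a b] w d.
    have [z [Ewz zR zw]] := replaced_start redK Kwd.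
    apply: (@connect_trans _ _ z); last exact/walk_sub/(replaced_walk redK Kwd).
    by apply: connect1; rewrite /= -/(verts K') W'P eqxx Ewz.
  case/setUP: tR => tR.
    apply: connect_trans wd; apply/walk_sub/(replaced_walk redK (Kcw c Kwc)) => //.
    by rewrite (replaced_sym redK).
  have [->//|tw] := eqVneq t w.
  exact/walk_sub/(replaced_walk redK Kwd).
have bridge c d : adj K w c -> adj K w d -> c != d -> [set c; d] = [set a; b] ->
    ~~ connect (del_edge K' c d) c d.
  move=> Kwc Kwd cd cdE; apply: contraNN (adj_bridge redK (Kcw c Kwc)) => con.
  apply: (@connect_trans _ _ d).
    apply: connect_sub con => x y; rewrite /del_edge /= cdE.
    case: eqP => [//|_] /= /andP[/and3P[xw yw Kxy] _].
    by apply: connect1; rewrite /= Kxy set2_neqr.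
  apply: connect1; rewrite /del_edge /= Kcw //= [[set c; w]]setUC.
  by apply: set2_neqr; rewrite eq_sym // cw.
have ba : b != a by rewrite eq_sym.
split.
- move=> x y; rewrite /K' /= (adj_sym redK) [[set x; y]]setUC.
  by rewrite [(x != w) && _]andbCA.
- move=> x y /adjP[[-> ->]|[-> ->]|[_ xw yw Kxy]]; rewrite /K' /= !inE.
  + by rewrite !cw ?cW.
  + by rewrite !cw ?cW.
  + by have [-> -> ->] := adj_verts redK Kxy; rewrite xw yw.
- move=> x y /adjP[[-> ->]|[-> ->]|[_ xw yw Kxy]]; [exact: bridge | |].
    by apply: bridge => //; rewrite setUC.
  apply: contraNN (adj_bridge redK Kxy); apply: connect_sub => s t.
  have wconn c : adj K w c -> connect (del_edge K x y) w c.
    move=> Kwc; apply: connect1; rewrite /del_edge /= Kwc eq_sym setUC.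
    by rewrite [[set w; c]]setUC [y |: _]setUC set2_neqr.
  have connw c : adj K w c -> connect (del_edge K x y) c w.
    by move=> Kwc; rewrite (sym_connect_sym (del_edge_sym redK x y)) wconn.
  case/andP=> /adjP[[-> ->]|[-> ->]|[_ _ _ Kst]] neq.
  + by apply: (@connect_trans _ _ w); auto.
  + by apply: (@connect_trans _ _ w); auto.
  + by apply: connect1; rewrite /del_edge /= Kst.
- move=> x y; rewrite /K' /= [[set x; y]]setUC; case: ifP => // _.
  exact: replaced_sym.
- move=> x y /adjP[[-> ->]|[-> ->]|[nn xw yw Kxy]].
  + by rewrite Rab inE (replaced_sym redK) replaced_end // Kcw.
  + by rewrite Rba inE orbC (replaced_sym redK) replaced_end // Kcw.
  + by rewrite Rold // replaced_end.
- move=> x y t Kxy' tW' tR; move: tW' tR; rewrite [t \in verts K']/= !inE.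
  case/andP=> tw tW.
  have tRab : t \in replaced K w a :|: replaced K w b -> t = a \/ t = b.
    case/setUP => tR.
      by have [tE|] := replaced_verts redK Kwa tW tR; [rewrite tE eqxx in tw | left].
    by have [tE|] := replaced_verts redK Kwb tW tR; [rewrite tE eqxx in tw | right].
  case/adjP: Kxy' => [[-> ->]|[-> ->]|[nn _ _ Kxy]].
  + by rewrite Rab.
  + by rewrite Rba => /tRab[]; [right | left].
  + by rewrite Rold //; apply: replaced_verts.
- move=> t t' Ett'; have [x [y [Kxy tR t'R]]] := replaced_cover redK Ett'.
  have old c : adj K w c -> t \in replaced K w c -> t' \in replaced K w c ->
      exists x y, [/\ adj K' x y, t \in replaced K' x y & t' \in replaced K' x y].
    move=> Kwc tRc t'Rc; exists a, b; rewrite Rab !inE; split=> //.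
      by move: Kwc; rewrite Kw => /orP[] /eqP <-; rewrite tRc ?orbT.
    by move: Kwc; rewrite Kw => /orP[] /eqP <-; rewrite t'Rc ?orbT.
  have [xw|xw] := eqVneq x w; first by rewrite xw in Kxy tR t'R; apply: (old y).
  have [yw|yw] := eqVneq y w.
    rewrite yw (adj_sym redK) in Kxy; rewrite yw (replaced_sym redK) in tR.
    by rewrite yw (replaced_sym redK) in t'R; apply: (old x).
  exists x, y; rewrite Rold ?tR ?t'R; first by rewrite /K' /= xw yw Kxy orbT.
  apply/eqP => /set2_eqP[] [xE yE]; rewrite xE yE in Kxy.
    by rewrite (negPf (notri _ _ Kwa Kwb ab)) in Kxy.
  by rewrite (negPf (notri _ _ Kwb Kwa ba)) in Kxy.
- have newold x y t : t \notin verts K' -> [/\ x != w, y != w & adj K x y] ->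
      t \in replaced K w a :|: replaced K w b -> t \notin replaced K x y.
    move=> tW [xw yw Kxy] tRab; apply/negP => tR.
    have wxy : w \notin [set x; y].
      by rewrite !inE negb_or ![w == _]eq_sym xw.
    have [tE|tw] := eqVneq t w.
      case/negP: wxy; apply/set2P; rewrite tE in tR.
      exact: replaced_verts redK _ _ _ Kxy wW tR.
    rewrite W'P (negPf tw) /= in tW.
    case/setUP: tRab => tR'.
      by rewrite (replaced_interior redK tW Kxy Kwa tR tR') set21 in wxy.
    by rewrite (replaced_interior redK tW Kxy Kwb tR tR') set21 in wxy.
  have newP x y : [set x; y] = [set a; b] \/ ([set x; y] == [set a; b]) = false.
    by case: eqP; [left | right].
  have oldP x y : ([set x; y] == [set a; b]) = false -> adj K' x y ->
      [/\ x != w, y != w & adj K x y].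
    by rewrite /K' /= => -> /and3P[].
  move=> x y x' y' t tW Kxy Kxy'.
  case: (newP x y) (newP x' y') => nn [] nn'; rewrite ?nn ?nn' //.
  + rewrite (Rnew _ _ nn) (Rold _ _ nn') => tR.
    by rewrite (negPf (newold _ _ _ tW (oldP _ _ nn' Kxy') tR)).
  + rewrite (Rnew _ _ nn') (Rold _ _ nn) => tR tR'.
    by rewrite (negPf (newold _ _ _ tW (oldP _ _ nn Kxy) tR')) in tR.
  + rewrite !Rold //; have [xw yw {}Kxy] := oldP _ _ nn Kxy.
    have [x'w y'w {}Kxy'] := oldP _ _ nn' Kxy'.
    move: tW; rewrite W'P => /orP[/eqP->|tW] tR tR'; last first.
      exact: (replaced_interior redK tW).
    have [wE|wE] := replaced_verts redK Kxy wW tR; first by rewrite wE eqxx in xw.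
    by rewrite wE eqxx in yw.
- move=> x y /adjP[[-> ->]|[-> ->]|[nn xw yw Kxy]].
  + by have [z [Ez zR za]] := start a Kwa; exists z; rewrite Rab inE zR.
  + by have [z [Ez zR za]] := start b Kwb; exists z; rewrite Rba inE zR orbT.
  + by rewrite Rold //; apply: replaced_start.
- move=> x y t t' /adjP[[-> ->]|[-> ->]|[nn xw yw Kxy]].
  + by rewrite Rab; apply: start_uniq.
  + by rewrite Rba setUC; apply: start_uniq.
  + by rewrite Rold //; apply: replaced_start_uniq.
- move=> x y t /adjP[[-> ->]|[-> ->]|[nn xw yw Kxy]].
  + by rewrite Rab; apply: walk.
  + by rewrite Rba setUC; apply: walk.
  + by rewrite Rold // => tR tx; apply/walk_sub/(replaced_walk redK Kxy).
- move=> t; rewrite W'P => /orP[/eqP->|]; last exact: suppressed_degree.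
  pose N c := [set y in replaced K w c | E0 w y].
  have N1 c : adj K w c -> #|N c| <= 1.
    move=> Kwc; apply/card_le1_eqP => x y; rewrite !inE => /andP[xR Ex] /andP[yR Ey].
    exact: (replaced_start_uniq redK Kwc).
  have sub : [set y in setT | E0 w y] \subset N a :|: N b.
    apply/subsetP => z; rewrite !inE /= => Ewz; rewrite Ewz !andbT.
    have [x [y [Kxy wR zR]]] := replaced_cover redK Ewz.
    have [wx|wy] := replaced_verts redK Kxy wW wR.
      rewrite -wx Kw in Kxy; rewrite -wx in zR.
      by case/orP: Kxy => /eqP yE; rewrite -yE zR ?orbT.
    rewrite -wy (adj_sym redK) Kw in Kxy; rewrite -wy (replaced_sym redK) in zR.
    by case/orP: Kxy => /eqP xE; rewrite -xE zR ?orbT.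
  apply: leq_trans (subset_leq_card sub) _.
  by apply: leq_trans (leq_card_setU _ _) _; rewrite (leq_add (N1 a _) (N1 b _)).
- by move=> t; rewrite W'P => /orP[/eqP->|] //; apply: suppressed_endvertex.
- move=> x y v Kxy vI xF yF.
  have abF : a \in F v -> b \in F v -> red K w a.
    move=> aF bF; apply: (red_ipath redK Kwa vI) => //.
    exact: (between_neighbours redK (Kcw a Kwa) Kwb).
  rewrite /K' /=; case: ifP => [/eqP/set2_eqP[] [xE yE]|nn].
  + by apply: abF; rewrite -?xE -?yE.
  + by apply: abF; rewrite -?xE -?yE.
  + move: Kxy; rewrite /K' /= nn => /and3P[_ _ Kxy].
    exact: (red_ipath redK Kxy vI).
Qed.

Lemma reduction_suppresses_to K K' :
  reduction K -> suppresses_to E0 F I K K' -> reduction K'.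
Proof.
move=> redK KK'; elim: KK' redK => // {}K w a b {}K' sup _ IH redK.
exact/IH/reduction_suppress.
Qed.

End Reduction.

Section Separation.
Variables (V T0 : finType) (G : rel V) (E0 : rel T0) (F : V -> {set T0}).
Variables (I : {set V}) (K : ctree T0) (r s : T0).
Hypothesis simpleG : simple_graph G.
Hypothesis repF : tree_rep G E0 F.
Hypothesis admI : admissible_choice G E0 F I.
Hypothesis redK : reduction E0 F I K.
Hypothesis Krs : adj K r s.

Let symE : symmetric E0. Proof. by case: repF => -[[]]. Qed.
Let connF v : connected_in E0 (F v). Proof. by case: repF => _ /(_ v)[]. Qed.

Lemma ipath_suppressed y t t' : y \in I -> t \in F y -> t \notin verts K ->
  E0 t t' -> t' \in F y.
Proof.
move=> yI tF tW Ett'.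
have deg : 1 < #|[set z in F y | E0 t z]|.
  have := suppressed_endvertex redK tW.
  by rewrite negb_exists_in => /forall_inP/(_ y yI); rewrite negb_and tF /= -ltnNge.
have /subset_leqif_cards[_ eqN] :
    [set z in F y | E0 t z] \subset [set z in setT | E0 t z].
  by apply/subsetP => z; rewrite !inE => /andP[].
have : t' \in [set z in setT | E0 t z] by rewrite !inE.
have /eqP <- : [set z in F y | E0 t z] == [set z in setT | E0 t z].
  rewrite -eqN eqn_leq subset_leq_card /=; last first.
    by apply/subsetP => z; rewrite !inE => /andP[].
  exact: leq_trans (suppressed_degree redK tW) deg.
by rewrite inE => /andP[].
Qed.

Lemma ipath_interior y t : y \in I -> t \in F y -> t \notin verts K ->
  t \in replaced K r s -> r \in F y /\ s \in F y.
Proof.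
move=> yI tF tW tR; have [rW sW _] := adj_verts redK Krs.
have reach z : connect [rel a b | (a \notin verts K) && E0 a b] t z -> z \in F y.
  move=> tz; apply/negPn/negP => zF.
  have [x [x' [/andP[xW Exx'] xF]]] := connect_crossing tz tF zF.
  by rewrite (ipath_suppressed yI xF xW Exx').
split; apply: reach.
  apply: (replaced_walk redK (y := r) (x := s)); rewrite ?(adj_sym redK s) //.
    by rewrite (replaced_sym redK).
  by apply: contraNneq tW => ->.
by apply: (replaced_walk redK Krs) => //; apply: contraNneq tW => ->.
Qed.

Lemma not_in_interior z :
  exists2 t, t \in F z & (t \in verts K) || (t \notin replaced K r s).
Proof.
have [_ subF GE] := repF; have [[indI pathI] maxI minI] := admI.
have [rW _ _] := adj_verts redK Krs.
apply/exists_inP; apply: contraT; rewrite negb_exists_in => /forall_inP noF.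
have {noF}inM t : t \in F z -> t \notin verts K /\ t \in replaced K r s.
  by move/noF; rewrite negb_or negbK => /andP.
have [/set0Pn[t0 t0F] _] := subF z.
have rF : r \notin F z by apply/negP => /inM[]; rewrite rW.
case: (boolP (z \in I)) => zI.
  have [t0W t0R] := inM _ t0F.
  by have [rF' _] := ipath_interior zI t0F t0W t0R; rewrite rF' in rF.
case: (boolP [exists y in I, G z y]) => [/exists_inP[y yI Gzy]|].
  have zy : z != y by apply: contraNneq zI => ->.
  move: Gzy; rewrite GE // disjoint_subset => /subsetPn[t tz].
  rewrite !inE negbK => ty; have [tW tR] := inM _ tz.
  have [rFy _] := ipath_interior yI ty tW tR.
  case/negP: (minI y yI z); apply/properP; split; last by exists r.
  apply/subsetP => t' t'z; apply/negPn/negP => t'y.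
  have [x [x' [xz _ Exx' xy]]] := connected_crossing (@connF z) tz t'z ty t'y.
  by rewrite (ipath_suppressed yI xy _ Exx') //; case: (inM _ xz).
rewrite negb_exists_in => /forall_inP noG.
have degz : {in F z, forall t, degree_in E0 setT t <= 2}.
  by move=> t /inM[tW _]; exact: (suppressed_degree redK tW).
case/negP: zI; rewrite -(maxI (z |: I)) ?setU11 ?subsetUr //; split.
  move=> x y /setU1P[->|xI] /setU1P[->|yI]; last exact: indI.
  - by case: simpleG => _ ->.
  - exact: noG.
  - by case: simpleG => -> _; apply: noG.
move=> x /setU1P[->|/pathI//]; split=> //.
exact: connected_degree2_is_path.
Qed.

Section Cut.
Variable D : {set T0}.
Hypothesis cutD : forall x y, adj K x y -> (x \in D) != (y \in D) ->
  [set x; y] = [set r; s].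
Hypotheses (rD : r \in D) (sD : s \notin D).

Lemma side_cover t :
  [\/ t \in side K D, t \in side K (~: D) |
      t \notin verts K /\ t \in replaced K r s].
Proof.
have [rW _ _] := adj_verts redK Krs.
case: (boolP (t \in verts K)) => tW.
  case: (boolP (t \in D)) => tD; first by constructor 1; rewrite side_verts.
  by constructor 2; rewrite side_verts // inE.
have [[_ _ connT _] _ _] := repF.
have [t1 [t2 [_ _ Et /set1P t1E _]]] : exists t1 t2,
    [/\ t1 \in setT, t2 \in setT, E0 t1 t2, t1 \in [set t] & t2 \notin [set t]].
  apply: (connected_crossing (y := r) connT); rewrite ?inE //.
  by apply: contraNneq tW => <-.
have [x [y [Kxy]]] := replaced_cover redK Et; rewrite t1E => tR _.
have := cutD Kxy.
case: (boolP (x \in D)) => xD; case: (boolP (y \in D)) => yD /=.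
- by constructor 1; apply/sideP => //; exists x, y.
- case/(_ isT)/set2_eqP=> -[xE yE]; constructor 3; rewrite -?xE -?yE //.
  by rewrite (replaced_sym redK).
- case/(_ isT)/set2_eqP=> -[xE yE]; constructor 3; rewrite -?xE -?yE //.
  by rewrite (replaced_sym redK).
- by constructor 2; apply/sideP => //; exists x, y; rewrite !inE.
Qed.

Lemma connected_crossing_r X t t' : connected_in E0 X -> t \in X -> t' \in X ->
  t \in side K D -> t' \notin side K D -> r \in X.
Proof.
move=> cX tX t'X tD t'D.
have [x [y [xX Kxy xD yD]]] := connected_side_exit redK cX tX t'X tD t'D.
have := cutD Kxy; rewrite xD (negPf yD) => /(_ isT)/set2_eqP[] [xE _].
  by rewrite -xE.
by rewrite xE (negPf sD) in xD.
Qed.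

Lemma connected_crossing_s X t t' : connected_in E0 X -> t \in X -> t' \in X ->
  t \in side K (~: D) -> t' \notin side K (~: D) -> s \in X.
Proof.
move=> cX tX t'X tD t'D.
have [x [y [xX Kxy]]] := connected_side_exit redK cX tX t'X tD t'D.
rewrite !in_setC negbK => xD yD.
have := cutD Kxy; rewrite (negPf xD) yD => /(_ isT)/set2_eqP[] [xE _].
  by rewrite xE rD in xD.
by rewrite -xE.
Qed.

Lemma enclosed_not_connected (S : {set V}) u v p q :
  (forall z, z \notin S -> r \in F z -> s \notin F z) ->
  (forall z z', z \notin S -> z' \notin S -> z \notin I -> z' \notin I ->
     z != z' -> G z z' -> r \in F z -> s \notin F z') ->
  p \in verts K -> p \in F u -> p \in D ->
  q \in verts K -> q \in F v -> q \notin D ->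
  v \notin S -> ~~ connect (induced G (~: S)) u v.
Proof.
move=> noboth nopair pW pF pD qW qF qD vS; apply/negP => uv.
have [rW sW _] := adj_verts redK Krs.
have [_ _ GE] := repF.
have r_nB : r \notin side K (~: D) by rewrite side_verts // inE negbK.
have s_nA : s \notin side K D by rewrite side_verts.
pose A := [set z | [exists t in F z, t \in side K D]].
have uA : u \in A.
  by rewrite inE; apply/exists_inP; exists p; rewrite ?side_verts.
have vA : v \notin A.
  rewrite inE; apply/exists_inP => -[t tF tA].
  have rF : r \in F v.
    by apply: (connected_crossing_r (@connF v) tF qF tA); rewrite side_verts.
  case/negP: (noboth v vS rF).
  by apply: (connected_crossing_s (@connF v) qF rF) => //; rewrite side_verts // inE.
have [z [z' [/and3P[zS z'S Gzz']]]] := connect_crossing uv uA vA.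
rewrite !inE in zS z'S *; move=> /exists_inP[t tF tA].
rewrite negb_exists_in => /forall_inP z'A.
have zz' : z != z' by apply: contraTneq Gzz' => ->; case: simpleG => _ ->.
move: (Gzz'); rewrite GE // disjoint_subset => /subsetPn[m mz].
rewrite !inE negbK => mz'.
have rz : r \in F z := connected_crossing_r (@connF z) tF mz tA (z'A _ mz').
have sz := noboth z zS rz.
have zB y : y \in F z -> y \notin side K (~: D).
  move=> yz; apply: contraNN sz => yB.
  exact: (connected_crossing_s (@connF z) yz rz yB).
case: (side_cover m) => [mA|mB|[mW mR]].
- by rewrite (negPf (z'A _ mz')) in mA.
- by rewrite (negPf (zB _ mz)) in mB.
have sz' : s \in F z'.
  have [y yz' yM] := not_in_interior z'.
  case: (side_cover y) => [yA|yB|[yW yR]].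
  - by rewrite (negPf (z'A _ yz')) in yA.
  - exact: (connected_crossing_s (@connF z') yz' mz' yB (zB _ mz)).
  - by rewrite (negPf yW) yR in yM.
case: (boolP (z \in I)) => zI.
  by have [_ sz2] := ipath_interior zI mz mW mR; rewrite sz2 in sz.
case: (boolP (z' \in I)) => z'I.
  have [rz' _] := ipath_interior z'I mz' mW mR.
  by case/negP: (z'A _ rz'); rewrite side_verts.
by have := nopair z z' zS z'S zI z'I zz' Gzz' rz; rewrite sz'.
Qed.

End Cut.
End Separation.

Theorem lemma4p3 (V T0 : finType) (G : rel V) (E0 : rel T0)
    (F : V -> {set T0}) (I : {set V}) (T : ctree T0) (r s : T0)
    (C S : {set V}) (u v : V)
    (hG : simple_graph G) (hchordal : chordal G)
    (hF : minimum_tree_rep G E0 F)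
    (hI : admissible_choice G E0 F I)
    (hT : base_tree E0 F I T)
    (he : adj T r s)
    (hC : overspan_cover G F I r s C)
    (hblack : ~~ red T r s -> S = C)
    (hred : red T r s ->
      exists2 x, corresponding_ipath F I T r s x & S = x |: C)
    (huS : u \notin S) (hvS : v \notin S)
    (huv : enclosing_pair F T r s u v) :
  ~~ connect (induced G (~: S)) u v.
Proof.
have [repF _] := hF; have [treeE subF GE] := repF; have [symG irrG] := hG.
have [sup _] := hT; have [CI covC] := hC; have [[indI _] _ _] := hI.
have redT := reduction_suppresses_to treeE subF (reduction_initial F I treeE) sup.
have CS : C \subset S.
  case: (boolP (red T r s)) => [/hred[x _ ->]|/hblack->//].
  exact: subsetUr.
have noboth z : z \notin S -> r \in F z -> s \notin F z.
  move=> zS rz; apply/negP => sz.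
  case: (boolP (z \in I)) => zI; last first.
    have : overspan G F I r s z z by rewrite /overspan /= zI eqxx rz sz.
    by move/covC; rewrite orbb => /(subsetP CS); rewrite (negPf zS).
  have [x [xI _ xR] SE] := hred (red_ipath redT he zI rz sz).
  have rx : r \in F x by rewrite xR (replaced_end redT).
  have [zx|zx] := eqVneq z x; first by rewrite zx SE setU11 in zS.
  have := indI z x zI xI; rewrite GE // negbK => /disjointFr/(_ rz).
  by rewrite rx.
have nopair z z' : z \notin S -> z' \notin S -> z \notin I -> z' \notin I ->
    z != z' -> G z z' -> r \in F z -> s \notin F z'.
  move=> zS z'S zI z'I zz' Gzz' rz; apply/negP => sz'.
  have : overspan G F I r s z z'.
    by rewrite /overspan /= zI z'I (negPf zz') Gzz' rz sz'.
  case/covC/orP => /(subsetP CS); first by rewrite (negPf zS).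
  by rewrite (negPf z'S).
have [p [q [/setIP[pW pF] /setIP[qW qF] pq]]] := huv.
pose D := branch T r s p.
have pD : p \in D by rewrite inE connect0.
have qD : q \notin D by rewrite inE.
have cutD x y : adj T x y -> (x \in D) != (y \in D) -> [set x; y] = [set r; s].
  exact: (branch_exit redT).
have [_ _ connT _] := treeE.
have [x [y [_ Txy xD yD]]] : exists x y,
    [/\ x \in setT, adj T x y, x \in D & y \notin D].
  by apply: (connected_side_exit (t := p) (t' := q) redT connT); rewrite ?side_verts.
have := cutD _ _ Txy; rewrite xD (negPf yD) => /(_ isT)/set2_eqP[] [xE yE].
  rewrite xE in xD; rewrite yE in yD.
  exact: (enclosed_not_connected hG repF hI redT he cutD xD yD noboth nopair
    pW pF pD qW qF qD hvS).
rewrite xE in xD; rewrite yE in yD.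
rewrite (sym_connect_sym (e := induced G (~: S))); last first.
  by move=> z z'; rewrite /induced /= symG andbCA.
apply: (enclosed_not_connected hG repF hI redT he (D := ~: D) _ _ _ noboth nopair
  qW qF _ pW pF) => //; rewrite ?in_setC ?negbK //.
by move=> z z' Tzz' neq; apply: cutD => //; apply: contraNneq neq; rewrite !in_setC => ->.
Qed.
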